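(* Let $G$ be a graph on $n$ vertices, and let $\mu_1\le\cdots\le\mu_n$ be the Laplacian eigenvalues of $\overline{G^{[\sharp t]}}$, the complement of the exact distance $t$-power of $G$. Then $$\mathrm{eq}_t(G)\le n\left(1-\frac{\mu_2}{\mu_n}\right)+1.$$
   Context: Here $t$ is a positive integer and $d(u,v)$ is the shortest-path distance in $G$. The exact distance $t$-power $G^{[\sharp t]}$ is the graph on the vertex set $V(G)$ in which two vertices are adjacent if and only if they are at distance exactly $t$ in $G$; $\overline{H}$ denotes the complement of a graph $H$. The Laplacian of a graph is its diagonal degree matrix minus its adjacency matrix, and its eigenvalues are listed with multiplicity. A set $S\subseteq V(G)$ is $t$-equidistant if $d(u,v)=t$ for all distinct $u,v\in S$, and $\mathrm{eq}_t(G)$ is the number of vertices in a largest $t$-equidistant set of $G$. *)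

(* Defs.v *)
From mathcomp Require Import all_boot all_order all_algebra.

Set Implicit Arguments.
Unset Strict Implicit.
Unset Printing Implicit Defensive.

Import Order.TTheory GRing.Theory Num.Theory.

(* A finite simple graph on the vertex set T is a relation e : rel T assumed
   symmetric and irreflexive. *)

Section Distance.
Variables (T : finType) (e : rel T).

Definition has_path (k : nat) (u v : T) : bool :=
  [exists p : k.-tuple T, [&& path e u p, uniq (u :: p) & last u p == v]].

(* The least length of a path from u to v, or None (infinite distance) when u
   and v lie in different components.  A path has no repeated vertex, so only
   the lengths below #|T| are relevant. *)
Definition dist (u v : T) : option nat :=
  ohead [seq k <- iota 0 #|T| | has_path k u v].

Definition exact_distance_power (t : nat) : rel T :=
  [rel u v | dist u v == Some t].

Definition equidistant (t : nat) (S : {set T}) : bool :=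
  [forall u in S, forall v in S, (u != v) ==> (dist u v == Some t)].

Definition eq_number (t : nat) : nat :=
  \max_(S : {set T} | equidistant t S) #|S|.

Definition compl_graph : rel T := [rel u v | (u != v) && ~~ e u v].

End Distance.

Section Laplacian.
Local Open Scope ring_scope.
Variables (R : rcfType) (T : finType) (e : rel T).

Definition degree (u : T) : nat := #|[set v | e u v]|.

Definition degree_mx : 'M[R]_#|T| :=
  diag_mx (\row_i (degree (enum_val i))%:R).

Definition adjacency_mx : 'M[R]_#|T| :=
  \matrix_(i, j) (e (enum_val i) (enum_val j))%:R.

Definition laplacian : 'M[R]_#|T| := degree_mx - adjacency_mx.

(* mu lists the eigenvalues in nondecreasing order, with multiplicity: it is
   the sorted tuple of roots of the characteristic polynomial. *)
Definition laplacian_spectrum (mu : #|T|.-tuple R) : Prop :=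
  sorted <=%R mu /\ char_poly laplacian = \prod_(a <- mu) ('X - a%:P).

End Laplacian.

(* Main.v *)
(* A t-equidistant set S is an independent set of the complement H of the exact
   distance power.  Let L be the Laplacian of H and s = |S|.  The Rayleigh
   quotient of L at n 1_S - s 1 is at most mu_n, and at n 1_v - 1, for v in S,
   at least mu_2.  As S is independent, the two quadratic forms are
   n^2 vol(S) and n^2 deg(v), where vol(S) is the sum of the degrees over S.
   Hence s mu_2 (n - 1) <= n vol(S) <= mu_n s (n - s), so that
   mu_2 (n - 1) <= mu_n (n - s), and mu_2 <= mu_n gives the bound.
   The bound is trivial unless mu_2 > 0, in which case the kernel of L is
   spanned by 1.  The Rayleigh bounds come from the unitary
   diagonalization of L over R[i]. *)

Require Import Defs.
From mathcomp Require Import all_boot all_order all_algebra perm ring lra.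
From mathcomp Require Import complex.

Set Implicit Arguments.
Unset Strict Implicit.
Unset Printing Implicit Defensive.

Import Order.TTheory GRing.Theory Num.Theory.
Local Open Scope ring_scope.
Local Open Scope sesquilinear_scope.

(** * Unitary diagonalization with a prescribed order of the eigenvalues *)

Lemma char_poly_similar (F : comUnitRingType) n (P A : 'M[F]_n) :
  P \in unitmx -> char_poly (invmx P *m A *m P) = char_poly A.
Proof.
move=> Pu; rewrite /char_poly.
have -> : char_poly_mx (invmx P *m A *m P) =
    map_mx polyC (invmx P) *m char_poly_mx A *m map_mx polyC P.
  rewrite /char_poly_mx mulmxBr mulmxBl mul_mx_scalar -scalemxAl -!map_mxM /=.
  by rewrite mulVmx // map_mx1 scalemx1.
rewrite !det_mulmx mulrAC -det_mulmx -map_mxM mulVmx // map_mx1 det1.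
by rewrite mul1r.
Qed.

(** The spectral theorem yields the eigenvalues in an uncontrolled order. Similar matrices share
    their characteristic polynomial, whose linear factors are unique up to order, and [sigma]
    records the reordering. *)
Lemma spectral_diag_perm (C : numClosedFieldType) n (A : 'M[C]_n)
    (s : n.-tuple C) :
  A \is normalmx -> char_poly A = \prod_(a <- s) ('X - a%:P) ->
  exists2 P, P \is unitarymx &
    exists sigma : 'S_n, A = P^t* *m diag_mx (\row_i tnth s (sigma i)) *m P.
Proof.
move=> /orthomx_spectralP A_E A_char.
set P := spectralmx A in A_E; set d := spectral_diag A in A_E.
have Pu : P \is unitarymx := spectral_unitarymx A.
exists P => //.
have: perm_eq [tuple d 0 i | i < n] s.
  apply: prod_XsubC_eq; rewrite -A_char A_E char_poly_similar; last first.
    exact: unitarymx_unit.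
  rewrite char_poly_trig ?diag_mx_is_trig // big_map big_enum /=.
  by apply: eq_bigr => i _; rewrite !mxE eqxx mulr1n.
case/tuple_permP => sigma s_E; exists sigma.
rewrite -invmx_unitary // {1}A_E; congr (_ *m diag_mx _ *m _).
apply/rowP => i; rewrite mxE.
have /(congr1 (fun t => tnth t i)) : [tuple d 0 i | i < n]
    = [tuple tnth s (sigma i) | i < n] by apply: val_inj.
by rewrite !tnth_mktuple.
Qed.

(** * Rayleigh bounds for a real symmetric matrix *)

Section Rayleigh.
Variables (R : rcfType) (n : nat) (A : 'M[R]_n) (mu : n.-tuple R).
Hypotheses (A_sym : A^T = A)
  (A_char : char_poly A = \prod_(a <- mu) ('X - a%:P)).

Local Notation toC := (real_complex R).

(** Here [c x] holds the coordinates of [x] in a unitary eigenbasis over [R[i]]: the dot product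
    becomes the Hermitian one, and [A] acts diagonally. *)
Lemma spectral_coordinates :
  exists (c : 'rV[R]_n -> 'rV[R[i]]_n) (sigma : 'S_n),
  (forall x y, toC ((x *m y^T) 0 0) = \sum_i c x 0 i * (c y 0 i)^*) /\
  (forall x i, c (x *m A) 0 i = toC (tnth mu (sigma i)) * c x 0 i) /\
  c 0 = 0.
Proof.
have A_real : map_mx toC A \is a realmx.
  by apply/mxOverP => i j; rewrite mxE complex_real.
have [||P Pu [sigma A_E]] :=
    @spectral_diag_perm _ _ (map_mx toC A) [tuple of map toC mu].
- apply: symmetric_normalmx => //.
  by apply/is_hermitianmxP; rewrite /= expr0 scale1r map_mx_id // map_trmx A_sym.
- rewrite -map_char_poly A_char rmorph_prod big_map; apply: eq_bigr => a _.
  by rewrite rmorphB /= map_polyX map_polyC.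
exists (fun x => map_mx toC x *m P^t*), sigma; split=> [x y|].
(* Insert [P^t* *m P], which is the identity; [y] is real, so conjugation does not change it. *)
- have -> : toC ((x *m y^T) 0 0) = ((map_mx toC x *m P^t*) *m
      (map_mx toC y *m P^t*)^t*) 0 0.
    rewrite trmx_mul map_mxM /= trmxCK mulmxA mulmxKtV // -map_trmx.
    have -> : (map_mx toC y ^ Num.conj) = map_mx toC y.
      by apply: realmxC; apply/mxOverP => i j; rewrite mxE complex_real.
    by rewrite map_trmx -map_mxM [RHS]mxE.
  by rewrite mxE; apply: eq_bigr => i _; rewrite !mxE.
split=> [x i|]; last by rewrite map_mx0 mul0mx.
rewrite map_mxM A_E -!mulmxA (unitarymxP Pu) mulmx1 mulmxA.
by rewrite mul_mx_diag !mxE tnth_map mulrC; congr (_ * _).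
Qed.

(** In eigenvector coordinates both sides are sums of multiples of squared moduli, compared term by
    term. *)
Lemma rayleigh_le (a : R) (x : 'rV[R]_n) :
  (forall i, tnth mu i <= a) -> (x *m A *m x^T) 0 0 <= a * (x *m x^T) 0 0.
Proof.
move=> mu_le; have [c [sigma [dotE [mulE c0]]]] := spectral_coordinates.
rewrite -lecR rmorphM /= !dotE mulr_sumr; apply: ler_sum => i _.
by rewrite mulE -mulrA ler_wpM2r ?mul_conjC_ge0 ?lecR.
Qed.

(* As [b > 0], only one eigenvector coordinate of [u] can be nonzero, so [x],
   being orthogonal to [u], vanishes there. *)
Lemma rayleigh_ge (b : R) (i0 : 'I_n) (u x : 'rV[R]_n) :
  0 < b -> (forall i, i != i0 -> b <= tnth mu i) ->
  (u *m u^T) 0 0 != 0 -> u *m A = 0 -> x *m u^T = 0 ->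
  b * (x *m x^T) 0 0 <= (x *m A *m x^T) 0 0.
Proof.
move=> b_gt0 mu_ge u_neq0 uA xu.
have [c [sigma [dotE [mulE c0]]]] := spectral_coordinates.
(* The coordinate that carries the eigenvalue of index [i0], the only one not assumed to be at least
   [b]. *)
pose k := (sigma^-1)%g i0.
have mu_sigma_ge i : i != k -> b <= tnth mu (sigma i).
  by move=> i_neq; apply: mu_ge; rewrite (can2_eq (permK _) (permKV _)).
have cu i : i != k -> c u 0 i = 0.
  move=> /mu_sigma_ge mu_b; apply/eqP; move: (mulE u i); rewrite uA c0 mxE.
  move/esym/eqP; rewrite mulf_eq0 => /orP[/eqP/complexI mu0|//].
  by rewrite leNgt mu0 b_gt0 in mu_b.
have cuk : c u 0 k != 0.
  apply: contra u_neq0 => /eqP cuk; apply/eqP/complexI.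
  rewrite dotE big1 ?rmorph0 // => i _.
  by have [->|/cu ->] := eqVneq i k; rewrite ?cuk mul0r.
have cxk : c x 0 k = 0.
  have /esym/eqP := dotE x u; rewrite xu mxE rmorph0 (bigD1 k) //= big1 => [|i].
    by rewrite addr0 mulf_eq0 conjC_eq0 (negPf cuk) orbF => /eqP.
  by move=> /cu ->; rewrite conjC0 mulr0.
rewrite -lecR rmorphM /= !dotE mulr_sumr; apply: ler_sum => i _.
rewrite mulE; have [->|/mu_sigma_ge mu_b] := eqVneq i k.
  by rewrite cxk conjC0 !mulr0.
by rewrite -mulrA ler_wpM2r ?mul_conjC_ge0 ?lecR.
Qed.

End Rayleigh.

(** * Symmetry of the distance *)

Section Graph.
Variables (T : finType) (e : rel T).

Lemma has_path_sym k (u v : T) :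
  symmetric e -> has_path e k u v -> has_path e k v u.
Proof.
move=> e_sym /existsP[p /and3P[p_path p_uniq /eqP p_last]].
(* The reversed walk starts at [v], so its tail is the reversal of [u :: p] without its last
   vertex. *)
have sz : size (rev (belast u p)) == k by rewrite size_rev size_belast size_tuple.
have rev_E : v :: rev (belast u p) = rev (u :: p).
  by rewrite [u :: p]lastI rev_rcons p_last.
apply/existsP; exists (Tuple sz); apply/and3P; split.
- rewrite -p_last rev_path -(eq_path (e := e)) // => x y; exact: e_sym.
- by rewrite [X in uniq X]rev_E rev_uniq.
- by rewrite -(last_cons u) [X in last _ X]rev_E rev_cons last_rcons.
Qed.

Lemma dist_sym (u v : T) : symmetric e -> dist e u v = dist e v u.
Proof.
move=> e_sym; rewrite /dist; congr ohead; apply: eq_filter => k.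
by apply/idP/idP; apply: has_path_sym.
Qed.

(** * Quadratic forms of the Laplacian *)

Variable R : rcfType.
Hypothesis e_sym : symmetric e.
Local Notation L := (laplacian R e).
Implicit Types (f g : T -> R) (S : {set T}).

Let row_of f : 'rV[R]_#|T| := \row_i f (enum_val i).

Lemma row_of_dot f g : (row_of f *m (row_of g)^T) 0 0 = \sum_u f u * g u.
Proof.
rewrite mxE (big_enum_val (fun u => f u * g u)) /=.
by apply: eq_bigr => i _; rewrite !mxE.
Qed.

Lemma natr_card_set (P : pred T) : #|[set v | P v]|%:R = \sum_v (P v)%:R :> R.
Proof.
rewrite -sum1_card natr_sum big_mkcond /=; apply: eq_bigr => v _.
by rewrite inE; case: (P v).
Qed.

Lemma laplacian_sym : L^T = L.
Proof.
rewrite /laplacian linearB /= tr_diag_mx; congr (_ - _).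
by apply/matrixP => i j; rewrite !mxE e_sym.
Qed.

Lemma row_of_laplacian f : row_of f *m L =
  row_of (fun v => f v * (degree e v)%:R - \sum_u f u * (e u v)%:R).
Proof.
rewrite mulmxBr mul_mx_diag; apply/rowP => j; rewrite !mxE; congr (_ - _).
rewrite (big_enum_val (fun u => f u * (e u (enum_val j))%:R)) /=.
by apply: eq_bigr => i _; rewrite !mxE.
Qed.

Lemma laplacian_const : row_of (fun=> 1) *m L = 0.
Proof.
rewrite row_of_laplacian; apply/rowP => j; rewrite !mxE mul1r natr_card_set.
by apply/eqP; rewrite subr_eq0; apply/eqP/eq_bigr => u _; rewrite mul1r e_sym.
Qed.

(** No edge joins two vertices of [S], so only the diagonal of the Laplacian contributes. *)
Lemma laplacian_form_independent S :
  {in S &, forall u v, ~~ e u v} ->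
  let f u := (u \in S)%:R in
  (row_of f *m L *m (row_of f)^T) 0 0 = \sum_(u in S) (degree e u)%:R.
Proof.
move=> S_indep f; rewrite row_of_laplacian row_of_dot [RHS]big_mkcond /=.
apply: eq_bigr => v _; rewrite /f; case: ifP => vS; last by rewrite mulr0.
rewrite mul1r mulr1 big1 ?subr0 // => u _.
have [uS|] := boolP (u \in S); last by rewrite mul0r.
by rewrite (negPf (S_indep _ _ uS vS)) mulr0.
Qed.

(** This is [#|T|] times the projection of the indicator of [S] orthogonally to the constants; the
    scaling avoids division. *)
Let centered S := row_of (fun v => #|T|%:R * (v \in S)%:R - #|S|%:R).

Let sum_mem S : \sum_v (v \in S)%:R = #|S|%:R :> R.
Proof.
by rewrite -natr_card_set; congr (_%:R); apply: eq_card => v; rewrite inE.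
Qed.

Let sum_const (a : R) : \sum_(v : T) a = #|T|%:R * a.
Proof. by rewrite sumr_const mulr_natl. Qed.

Lemma centered_orthogonal S : centered S *m (row_of (fun=> 1))^T = 0.
Proof.
apply/matrixP => i j; rewrite !ord1 row_of_dot mxE.
under eq_bigr do rewrite mulr1.
by rewrite sumrB -mulr_sumr sum_mem sum_const subrr.
Qed.

Lemma centered_norm S :
  (centered S *m (centered S)^T) 0 0 = #|T|%:R * #|S|%:R * (#|T|%:R - #|S|%:R).
Proof.
rewrite row_of_dot.
have -> : \sum_u (#|T|%:R * (u \in S)%:R - #|S|%:R) *
    (#|T|%:R * (u \in S)%:R - #|S|%:R) =
    \sum_u ((#|T|%:R ^+ 2 - 2 * #|T|%:R * #|S|%:R) * (u \in S)%:R
            + #|S|%:R ^+ 2) :> R.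
  (* The indicator takes the values 0 and 1, so it equals its square. *)
  by apply: eq_bigr => u _; case: (u \in S) => /=; ring.
rewrite big_split sum_const -mulr_sumr sum_mem /=.
by set N := #|T|; set k := #|S|; ring.
Qed.

(** The constants lie in the left and right kernels of the Laplacian, so subtracting a constant does
    not affect the form. *)
Lemma centered_form S :
  {in S &, forall u v, ~~ e u v} ->
  (centered S *m L *m (centered S)^T) 0 0
  = #|T|%:R ^+ 2 * \sum_(u in S) (degree e u)%:R.
Proof.
move=> S_indep; rewrite -(laplacian_form_independent S_indep).
set a := row_of (fun u => (u \in S)%:R); set w := row_of (fun=> 1).
have -> : centered S = #|T|%:R *: a - #|S|%:R *: w.
  by apply/rowP => i; rewrite !mxE mulr1.
have w_L : w *m L = 0 := laplacian_const.
have L_w : L *m w^T = 0 by rewrite -laplacian_sym -trmx_mul w_L trmx0.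
rewrite mulmxBl -!scalemxAl w_L scaler0 subr0.
rewrite [(_ - _)^T]linearB /= [(_ *: a)^T]linearZ [(_ *: w)^T]linearZ /= mulmxBr.
rewrite -!scalemxAr -!scalemxAl -(mulmxA a L w^T) L_w mulmx0 !scaler0 subr0.
by rewrite scalerA mxE expr2.
Qed.

(** * The bound for independent sets *)

Lemma independent_card_le (e_irr : irreflexive e) (mu : #|T|.-tuple R) S :
  laplacian_spectrum e mu -> {in S &, forall u v, ~~ e u v} ->
  #|S|%:R <= #|T|%:R * (1 - mu`_1 / mu`_#|T|.-1) + 1.
Proof.
case=> mu_sorted mu_char S_indep; set n := #|T|; set M := mu`_n.-1.
have S_le : (#|S| <= n)%N := max_card _.
have mu_mono i j : (i <= j < n)%N -> mu`_i <= mu`_j.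
  case/andP=> ij jn; apply: (sorted_leq_nth le_trans le_refl 0 mu_sorted) => //.
    by rewrite inE size_tuple (leq_ltn_trans ij).
  by rewrite inE size_tuple.
have mu_le i : tnth mu i <= M.
  rewrite (tnth_nth 0); apply: mu_mono.
  have n_gt0 : (0 < n)%N := leq_ltn_trans (leq0n i) (ltn_ord i).
  by rewrite ltn_predL n_gt0 -ltnS prednK // ltn_ord.
have [T0|n_gt0] := posnP n.
  have -> : #|S| = 0%N by apply/eqP; rewrite -leqn0 -T0.
  have -> : n%:R = 0 :> R by rewrite T0.
  by rewrite mul0r add0r ler01.
have Rn_gt0 : 0 < n%:R :> R by rewrite ltr0n.
have unitE : (row_of (fun=> 1) *m (row_of (fun=> 1))^T) 0 0 = n%:R :> R.
  by rewrite row_of_dot sum_const !mulr1.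
(* The constant vector has Rayleigh quotient 0. *)
have M_ge0 : 0 <= M.
  have := rayleigh_le laplacian_sym mu_char (row_of (fun=> 1)) mu_le.
  by rewrite laplacian_const mul0mx mxE unitE pmulr_lge0.
have S_leR : #|S|%:R <= n%:R :> R by rewrite ler_nat.
(* If the second eigenvalue is at most 0, the right-hand side is at least [n + 1]; this includes
   [M = 0], where the quotient is 0 by convention. *)
have [mu1_le0|mu1_gt0] := leP mu`_1 0.
  have : mu`_1 / M <= 0 by rewrite mulr_le0_ge0 // invr_ge0.
  by move=> ?; nra.
(* For [n <= 1] the index 1 is out of range and [nth] returns its default 0. *)
have n_gt1 : (1 < n)%N.
  rewrite ltnNge; apply/negP => n_le1.
  by rewrite nth_default ?ltxx ?size_tuple // in mu1_gt0.
have mu1_M : mu`_1 <= M by apply: mu_mono; case: (n) n_gt1 => [|[|k]] //=.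
have M_gt0 : 0 < M := lt_le_trans mu1_gt0 mu1_M.
(* The empty set is treated apart, since a factor [#|S|] is cancelled below. *)
have [->|S_neq0] := eqVneq S set0.
  rewrite cards0; have : mu`_1 / M <= 1 by rewrite ler_pdivrMr // mul1r.
  by move=> ?; nra.
have S_gt0 : 0 < #|S|%:R :> R by rewrite ltr0n card_gt0.
pose vol : R := \sum_(u in S) (degree e u)%:R.
have vol_le : n%:R * vol <= M * (#|S|%:R * (n%:R - #|S|%:R)).
  have := rayleigh_le laplacian_sym mu_char (centered S) mu_le.
  rewrite centered_form // centered_norm -/n -/vol => le_vol.
  by rewrite -(ler_pM2l Rn_gt0); lra.
(* Apply the lower Rayleigh bound to the independent set [[set u]], with squared norm [n * (n - 1)]
   and form [n ^ 2] times the degree, then cancel [n]. *)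
have degree_ge u : mu`_1 * (n%:R - 1) <= n%:R * (degree e u)%:R.
  have mu_ge i : i != Ordinal n_gt0 -> mu`_1 <= tnth mu i.
    move=> i_neq; rewrite (tnth_nth 0); apply: mu_mono; rewrite ltn_ord andbT.
    by rewrite lt0n; apply: contra i_neq => i0; apply/eqP/val_inj/eqP.
  have := rayleigh_ge laplacian_sym mu_char mu1_gt0 mu_ge _ laplacian_const
            (centered_orthogonal [set u]).
  rewrite unitE (gt_eqF Rn_gt0) centered_form; last first.
    by move=> v w /set1P -> /set1P ->; rewrite e_irr.
  rewrite centered_norm cards1 big_set1 -/n => /(_ isT) le_deg.
  by rewrite -(ler_pM2l Rn_gt0); lra.
have vol_ge : mu`_1 * (n%:R - 1) * #|S|%:R <= n%:R * vol.
  rewrite /vol mulr_sumr mulr_natr -sumr_const; apply: ler_sum => u _.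
  exact: degree_ge.
(* Chain [vol_ge] with [vol_le] and cancel [#|S|]. *)
have key : mu`_1 * (n%:R - 1) <= M * (n%:R - #|S|%:R).
  by rewrite -(ler_pM2r S_gt0); lra.
rewrite -(ler_pM2r M_gt0).
have -> : (n%:R * (1 - mu`_1 / M) + 1) * M = n%:R * (M - mu`_1) + M.
  by field; rewrite gt_eqF.
(* By [key], [#|S| * M] is at most [n * (M - mu_2) + mu_2], and [mu_2 <= M]. *)
lra.
Qed.

End Graph.

(* mu`_0 <= ... <= mu`_(n - 1) are mu_1 <= ... <= mu_n. *)
Theorem proposition23 (R : rcfType) (T : finType) (G : rel T)
    (G_sym : symmetric G) (G_irr : irreflexive G)
    (n : nat) (card_T : #|T| = n) (t : nat) (t_gt0 : (0 < t)%N)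
    (mu : #|T|.-tuple R)
    (mu_spec :
       laplacian_spectrum (compl_graph (exact_distance_power G t)) mu) :
  (eq_number G t)%:R <= n%:R * (1 - mu`_1 / mu`_n.-1) + 1.
Proof.
(* The empty set is equidistant, so the maximum is attained by some [S]. *)
have [|S S_eq max_S] := @eq_bigmax_cond _ (equidistant G t) (fun S => #|S|).
  apply/card_gt0P; exists set0.
  by apply/forall_inP => u; rewrite inE.
rewrite -card_T [eq_number G t]max_S; apply: independent_card_le mu_spec _.
- move=> u v; rewrite /compl_graph /exact_distance_power /=.
  by rewrite [u == v]eq_sym (dist_sym u v G_sym).
- by move=> u; rewrite /compl_graph /= eqxx.
- move=> u v uS vS; rewrite /compl_graph /exact_distance_power /= negb_and negbK.
  have [//|u_neq_v] := eqVneq u v; rewrite /= negbK.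
  by have /forall_inP/(_ u uS)/forall_inP/(_ v vS) := S_eq; rewrite u_neq_v.
Qed.
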